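(* Suppose that $\mathbb{W}=\mathbb{W}_1\cap\cdots\cap\mathbb{W}_N\neq\emptyset$ (so that the constrained problem $\min_{w\in\mathbb{W}}J^{\mathrm{glob}}(w)$ is feasible and has a minimizer $w^\star\in\mathbb{W}$) and that for each $k=1,\dots,N$ there are constants $\lambda_{k,\min}>0$ and $\lambda_{k,\max}>0$ with $\lambda_{k,\min}I_M\le\nabla_w^2J_k(w)\le\lambda_{k,\max}I_M$ for all $w\in\mathbb{R}^M$. For $\eta>0$ let $w^o(\eta)$ be the unique minimizer over $\mathbb{R}^M$ of $J^{\mathrm{glob}}_\eta(w)=\sum_{k=1}^NJ_k(w)+\eta\sum_{k=1}^Np_k(w)$, and let $w^o(\infty)=\lim_{\eta\to\infty}w^o(\eta)$. Then $$\|w^\star-w^o(\infty)\|=0,$$ that is, $w^o(\eta)\to w^\star$ as $\eta\to\infty$, so that $w^o(\infty)$ is feasible and optimal for the problem of minimizing $J^{\mathrm{glob}}$ over $\mathbb{W}$.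
   Context: There are $N$ agents. Agent $k$ has a twice-differentiable cost $J_k:\mathbb{R}^M\to\mathbb{R}$ and a constraint set $$\mathbb{W}_k=\{w\in\mathbb{R}^M: h_{k,u}(w)=0,\ u=1,\dots,U_k;\ g_{k,l}(w)\le0,\ l=1,\dots,L_k\},$$ where the functions $h_{k,u}:\mathbb{R}^M\to\mathbb{R}$ are affine and the functions $g_{k,l}:\mathbb{R}^M\to\mathbb{R}$ are convex. Put $J^{\mathrm{glob}}(w)=\sum_{k=1}^NJ_k(w)$. The penalty functions are $$p_k(w)=\sum_{l=1}^{L_k}\delta^{\mathrm{IP}}(g_{k,l}(w))+\sum_{u=1}^{U_k}\delta^{\mathrm{EP}}(h_{k,u}(w)),$$ where $\delta^{\mathrm{IP}},\delta^{\mathrm{EP}}:\mathbb{R}\to\mathbb{R}$ are continuous convex functions such that $\delta^{\mathrm{IP}}(x)=0$ for $x\le0$ and $\delta^{\mathrm{IP}}(x)>0$ for $x>0$, while $\delta^{\mathrm{EP}}(0)=0$ and $\delta^{\mathrm{EP}}(x)>0$ for $x\ne0$. They are chosen so that the $p_k$ are differentiable and $\nabla_wp_k(w')=0$ whenever $w'\in\mathbb{W}$. For symmetric matrices, $X\le Y$ means that $Y-X$ is positive semidefinite, and $\|\cdot\|$ is the Euclidean norm. *)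

(* Defs.v *)
From HB Require Import structures.
From mathcomp Require Import all_boot all_order all_algebra.
From mathcomp Require Import all_classical all_reals all_analysis.

Set Implicit Arguments.
Unset Strict Implicit.
Unset Printing Implicit Defensive.

Import Order.TTheory GRing.Theory Num.Theory.
Import numFieldNormedType.Exports.

Local Open Scope classical_set_scope.
Local Open Scope ring_scope.

Section Calculus.
Context {R : realType} {M : nat}.
Implicit Types (f : 'rV[R]_M -> R) (w : 'rV[R]_M) (X Y : 'M[R]_M).

Definition grad f w : 'rV[R]_M := \row_(i < M) ('D_(delta_mx 0 i) f w : R).

(* Entry (i, j) is the i-th partial derivative of the j-th partial
   derivative. *)
Definition hessian f w : 'M[R]_M := 'J (grad f) w.

Definition twice_differentiable f : Prop :=
  (forall w, differentiable f w) /\ (forall w, differentiable (grad f) w).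

(* Symmetry is not part of the definition: the order is applied only to scalar
   matrices and to Hessians of twice (Frechet) differentiable functions, which
   are symmetric. *)
Definition psd X : Prop := forall v : 'rV[R]_M, 0 <= (v *m X *m v^T) 0 0.

Definition loewner_le X Y : Prop := psd (Y - X).

(* The norm `|w| provided by the library on 'rV[R]_M is the max norm. *)
Definition euclid_norm w : R := Num.sqrt (\sum_(i < M) w 0 i ^+ 2).

Definition affine f : Prop :=
  exists (a : {linear 'rV[R]_M -> R^o}) (b : R), forall w, f w = a w + b.

Definition is_minimizer (A : set 'rV[R]_M) f w : Prop :=
  A w /\ forall v, A v -> f w <= f v.

End Calculus.

Section Penalty.
Context {R : realType}.
Implicit Type delta : R -> R.

Definition ineq_penalty delta : Prop :=
  [/\ continuous delta,
      convex_function [set: R^o] delta,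
      forall x, x <= 0 -> delta x = 0 &
      forall x, 0 < x -> 0 < delta x].

Definition eq_penalty delta : Prop :=
  [/\ continuous delta,
      convex_function [set: R^o] delta,
      delta 0 = 0 &
      forall x, x != 0 -> 0 < delta x].

End Penalty.

Section Problem.
Context {R : realType} {N M : nat} {U L : 'I_N -> nat}.
Variables (J : 'I_N -> 'rV[R]_M -> R).
Variables (h : forall k : 'I_N, 'I_(U k) -> 'rV[R]_M -> R).
Variables (g : forall k : 'I_N, 'I_(L k) -> 'rV[R]_M -> R).
Variables (deltaIP deltaEP : R -> R).

Definition constraint_set (k : 'I_N) : set 'rV[R]_M :=
  [set w | (forall u, @h k u w = 0) /\ (forall l, @g k l w <= 0)].

Definition feasible_set : set 'rV[R]_M := \bigcap_k constraint_set k.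

Definition penalty (k : 'I_N) (w : 'rV[R]_M) : R :=
  \sum_(l < L k) deltaIP (@g k l w) + \sum_(u < U k) deltaEP (@h k u w).

Definition Jglob (w : 'rV[R]_M) : R := \sum_(k < N) J k w.

Definition Jglob_pen (eta : R) (w : 'rV[R]_M) : R :=
  \sum_(k < N) J k w + eta * \sum_(k < N) penalty k w.

End Problem.

(* Main.v *)
Require Import Defs.
From HB Require Import structures.
From mathcomp Require Import all_boot all_order all_algebra.
From mathcomp Require Import all_classical all_reals all_analysis.
From mathcomp Require Import unstable lra.

Set Implicit Arguments.
Unset Strict Implicit.
Unset Printing Implicit Defensive.

Import Order.TTheory GRing.Theory Num.Theory.
Import numFieldNormedType.Exports.

Local Open Scope classical_set_scope.
Local Open Scope ring_scope.

(* Along every segment the Hessian lower bound yields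
   J_k y >= J_k x + dJ_k(x)(y - x) + c |y - x|^2 with c > 0 (in the max norm,
   which the Euclidean norm dominates). Hence Jglob has compact sublevel sets
   and is strictly midpoint convex, and so is Jglob + eta P for the convex
   nonnegative P = \sum_k p_k. Since W = {P = 0}, all the minimizers exist and
   are unique. Finally Jglob (wo eta) <= Jglob wstar and eta P (wo eta) stays
   bounded, while P is bounded away from 0 on the compact set
   {Jglob <= Jglob wstar} minus any ball around wstar. *)

(** * Quadratic lower bounds from the Hessian *)

Lemma sqr_mx_norm_le (R : realType) M (v : 'rV[R]_M) :
  `|v| ^+ 2 <= (v *m v^T) 0 0.
Proof.
rewrite mxE; under eq_bigr do rewrite mxE -expr2.
have [v0|v0] := eqVneq (mx_norm v) 0.
  rewrite [`|v|]v0 expr0n/=; apply: sumr_ge0 => i _; exact: sqr_ge0.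
have [[i j] /= ij] := mx_norm_neq0 v0.
rewrite [`|v|]ij real_normK ?num_real// (ord1 i) (bigD1 j)//= lerDl.
by apply: sumr_ge0 => k _; exact: sqr_ge0.
Qed.

(** Both difference quotients are the same function of the increment, so a directional derivative
    along [v] suffices. *)
Lemma is_derive_line (R : realType) (V W : normedModType R) (f : V -> W)
    (x v : V) (t : R) (df : W) :
  is_derive (x + t *: v) v f df ->
  is_derive t 1 (fun s : R => f (x + s *: v)) df.
Proof.
move=> [dv <-].
have E :
    (fun h : R =>
       h^-1 *: (f (x + (h *: (1 : R) + t) *: v) - f (x + t *: v))) =
    (fun h : R => h^-1 *: (f (h *: v + (x + t *: v)) - f (x + t *: v))).
  by apply/funext => s; rewrite [s *: (1 : R)]mulr1 scalerDl addrCA.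
split; first by rewrite /derivable/= E.
by rewrite /derive/= E.
Qed.

Lemma diff_grad (R : realType) M (f : 'rV[R]_M -> R) (w v : 'rV[R]_M) :
  differentiable f w -> 'd f w v = (grad f w *m v^T) 0 0.
Proof.
move=> df; rewrite {1}(row_sum_delta v) linear_sum mxE/=; apply: eq_bigr => i _.
by rewrite linearZ /= !mxE -deriveE// mulrC.
Qed.

(** The Hessian is not assumed continuous, so the mean value theorem on the segment replaces
    Taylor's formula with integral remainder: once for [phi'], then for [phi] minus a quadratic. *)
Lemma tangent_lower_bound (R : realType) M (f : 'rV[R]_M -> R) (m : R)
    (x y : 'rV[R]_M) :
  0 < m -> twice_differentiable f ->
  (forall w, loewner_le m%:M (hessian f w)) ->
  f x + 'd f x (y - x) + m / 2 * `|y - x| ^+ 2 <= f y.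
Proof.
move=> m0 [df ddf] Hm; set v := y - x.
pose q : R := (v *m v^T) 0 0; pose phi (t : R) : R := f (x + t *: v).
pose phi' (t : R) : R := (grad f (x + t *: v) *m v^T) 0 0.
pose phi'' (t : R) : R := (v *m hessian f (x + t *: v) *m v^T) 0 0.
have dphi (t : R) : is_derive t 1 phi (phi' t).
  apply: is_derive_line; rewrite /phi' -diff_grad// -deriveE//.
  exact/derivableP/diff_derivable.
have dphi' (t : R) : is_derive t 1 phi' (phi'' t).
  have dg := @diff_derivable _ _ _ (grad f) _ v (ddf (x + t *: v)).
  (* A fixed linear combination of the partial derivatives along the line, to which the rules for
     sums and scalar multiples apply. *)
  have -> : phi' =
      \sum_(i < M) (v 0 i \*: (fun s : R => grad f (x + s *: v) 0 i)).
    apply/funext => s; rewrite /phi' mxE fct_sumE; apply: eq_bigr => i _.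
    by rewrite [v^T i 0]mxE mulrC.
  have -> : phi'' t = \sum_(i < M) v 0 i *: 'D_v (grad f) (x + t *: v) 0 i.
    rewrite /phi'' /hessian -deriveEjacobian// mxE; apply: eq_bigr => i _.
    by rewrite [v^T i 0]mxE mulrC.
  apply: is_derive_sum => i; apply: is_deriveZ.
  apply: (@is_derive_line _ _ _ (fun w => grad f w 0 i)).
  rewrite derive_mx// [X in is_derive _ _ _ X]mxE; apply: derivableP.
  by have /derivable_mxP := dg; apply.
have phi''_ge t : m * q <= phi'' t.
  have := Hm (x + t *: v) => /(_ v); rewrite mulmxBr mulmxBl mxE.
  by rewrite [X in _ + X]mxE mul_mx_scalar -scalemxAl [X in _ - X]mxE subr_ge0.
have dcont (F dF : R -> R) : (forall t : R, is_derive t 1 F (dF t)) ->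
    forall a b, {within `[a, b], continuous F}.
  move=> dF' a b; apply: continuous_subspaceT => t.
  by apply/differentiable_continuous/derivable1_diffP; exact: ex_derive.
have phi'_ge t : 0 <= t -> phi' 0 + m * q * t <= phi' t.
  move=> t0.
  have [s _ /eqP] := MVT_segment t0 (fun s _ => dphi' s) (dcont _ _ dphi' _ _).
  rewrite subr0 subr_eq => /eqP->; rewrite addrC lerD2r.
  exact: ler_wpM2r.
(* The quadratic is chosen so that [phi'_ge] says [0 <= psi' t] for [0 <= t]; hence
   [psi 0 <= psi 1], which is the claim with [q] in place of the squared max norm. *)
pose psi : R -> R := (fun t => phi t - phi' 0 * t - m * q / 2 * t ^+ 2).
pose psi' : R -> R := (fun t => phi' t - phi' 0 - m * q * t).
have dpsi (t : R) : is_derive t 1 psi (psi' t).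
  have -> : psi = phi - (phi' 0 \*: id) - ((m * q / 2) \*: (id ^+ 2)) by [].
  apply: is_derive_eq; rewrite /psi' /= /GRing.scale/= expr1 mulr1; lra.
have [s s01] :=
  MVT_segment ler01 (fun s _ => dpsi s) (dcont _ _ dpsi _ _).
rewrite /psi /psi' /phi scale0r addr0 scale1r subr0 !mulr0 !mulr1.
rewrite expr0n/= mulr0 expr1n !subr0 mulr1.
have s0 : 0 <= s by move: s01; rewrite in_itv/= => /andP[].
have phi0 : phi' 0 = 'd f x v by rewrite /phi' scale0r addr0 -diff_grad.
have := phi'_ge _ s0; rewrite phi0.
have qv : m * `|v| ^+ 2 <= m * q by rewrite ler_pM2l ?sqr_mx_norm_le.
have -> : f y = f (x + v) by rewrite /v addrC subrK.
lra.
Qed.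

(** * Minimization of coercive, strongly convex functions *)

Lemma closed_sublevel (R : realType) M (F : 'rV[R]_M -> R) (a : R) :
  continuous F -> closed [set w | F w <= a].
Proof.
by move=> cF; apply: (@preimage_closed _ _ F [set x | x <= a]).
Qed.

Section StronglyConvexMinimization.
Context {R : realType} {M : nat}.
Implicit Types (F P : 'rV[R]_M -> R) (w x y : 'rV[R]_M).

(** Strong convexity at midpoints only: enough for uniqueness of minimizers, and stable under adding
    a midpoint convex function. *)
Definition strongly_midconvex (c : R) F := forall x y,
  F (2^-1 *: (x + y)) + c * `|x - y| ^+ 2 <= (F x + F y) / 2.

Definition midconvex F := forall x y, F (2^-1 *: (x + y)) <= (F x + F y) / 2.

(** For continuous functions this is coercivity. *)
Definition compact_sublevels F := forall a, compact [set w | F w <= a].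

(** Average the bounds based at the midpoint [z] and taken at [x] and [y]: the linear terms cancel,
    and halving the displacement turns [c] into [c / 4]. *)
Lemma tangent_strongly_midconvex F
    (d : 'rV[R]_M -> {linear 'rV[R]_M -> R^o}) (c : R) :
  (forall x y, F x + d x (y - x) + c * `|y - x| ^+ 2 <= F y) ->
  strongly_midconvex (c / 4) F.
Proof.
move=> tF x y; set z := 2^-1 *: (x + y).
have dz : x - z = 2^-1 *: (x - y).
  by apply/rowP => i; rewrite !mxE; lra.
have dz' : y - z = - (2^-1 *: (x - y)).
  by apply/rowP => i; rewrite !mxE; lra.
have := tF z x; have := tF z y.
rewrite dz dz' linearN normrN normrZ exprMn ger0_norm//.
have -> : (2^-1 : R) ^+ 2 = 4^-1 by lra.
lra.
Qed.

Lemma tangent_compact_sublevels F (l : {linear 'rV[R]_M -> R^o}) (c : R) x :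
  0 < c -> continuous F -> continuous l ->
  (forall y, F x + l (y - x) + c * `|y - x| ^+ 2 <= F y) ->
  compact_sublevels F.
Proof.
move=> c0 cF cl tF a.
apply: bounded_closed_compact; last exact: closed_sublevel.
have /linear_boundedP lb : bounded_near l (nbhs (0 : 'rV[R]_M)).
  by apply: continuous_linear_bounded; exact: cl.
have [r r0 lr] := pinfty_ex_gt0 lb.
(* Beyond this radius [c * t - r] exceeds [a - F x]; the summand 1 gives [1 < t], so multiplying by
   [t] preserves this and contradicts [F y <= a]. *)
exists (`|x| + ((r + `|a - F x|) / c + 1)); split; first exact: num_real.
move=> b /ltW xb y /= Fya; apply: le_trans xb.
rewrite -(subrK x y) addrC (le_trans (ler_normD _ _))// lerD2l.
rewrite leNgt; apply/negP; set t := `|y - x| => ht.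
have D0 : 0 <= `|a - F x| := normr_ge0 _.
have ct : r + `|a - F x| < c * (t - 1) by rewrite mulrC -ltr_pdivrMr// ltrBrDr.
have t1 : 1 < t.
  apply: le_lt_trans ht; rewrite lerDr divr_ge0//; first lra.
  exact: ltW.
have lyx : - (r * t) <= l (y - x).
  by have := lr (y - x); rewrite ler_norml => /andP[].
have := tF y; rewrite -/t => H.
have := ler_norm (a - F x) => Da.
have : 0 <= (c * t - r) * (t - 1) by apply: mulr_ge0; lra.
lra.
Qed.

Lemma midconvexD_strongly c F P : strongly_midconvex c F -> midconvex P ->
  strongly_midconvex c (fun w => F w + P w).
Proof.
move=> sF mP x y.
have := sF x y; have := mP x y; lra.
Qed.

(** The midpoint of two distinct minimizers would have a strictly smaller value. *)
Lemma strongly_midconvex_uniq_minimizer c F (A : set 'rV[R]_M) x y :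
  0 < c -> strongly_midconvex c F ->
  (forall u v, A u -> A v -> A (2^-1 *: (u + v))) ->
  is_minimizer A F x -> is_minimizer A F y -> x = y.
Proof.
move=> c0 sF mA [Ax mx] [Ay my]; apply/eqP; rewrite -subr_eq0 -normr_eq0.
apply: contraT => nxy.
have : 0 < c * `|x - y| ^+ 2 by rewrite mulr_gt0// exprn_gt0// lt_def nxy/=.
have := sF x y; have := mx _ (mA _ _ Ax Ay); have := my _ Ax; lra.
Qed.

(** The extreme value theorem applies on the part of [A] where [F] is at most [F a]; the rest of [A]
    has larger values. *)
Lemma compact_sublevels_minimizer F (A : set 'rV[R]_M) :
  continuous F -> compact_sublevels F -> closed A -> A !=set0 ->
  exists x, is_minimizer A F x.
Proof.
move=> cF kF clA [a Aa].
have kK : compact ([set w | F w <= F a] `&` A) by apply: compact_closedI.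
have K0 : ([set w | F w <= F a] `&` A) !=set0 by exists a; split => //=.
have [x xK mx] := compact_EVT_min K0 kK (continuous_subspaceT cF).
move: xK; rewrite inE => -[/= xa Ax]; exists x; split => // v Av.
have [va|/ltW] := leP (F v) (F a); last exact: le_trans.
by apply: mx; rewrite inE.
Qed.

Lemma compact_sublevels_le F G : continuous G -> (forall w, F w <= G w) ->
  compact_sublevels F -> compact_sublevels G.
Proof.
move=> cG FG kF a; apply: (subclosed_compact _ (kF a)) => [|w /=].
  exact: closed_sublevel.
exact: le_trans.
Qed.

Lemma penalty_method_cvg F P (wo : R -> 'rV[R]_M) x :
  continuous F -> continuous P -> compact_sublevels F -> (forall w, 0 <= P w) ->
  (forall y, is_minimizer [set w | P w = 0] F y -> y = x) ->
  is_minimizer [set w | P w = 0] F x ->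
  (forall eta, 0 < eta ->
     is_minimizer setT (fun w => F w + eta * P w) (wo eta)) ->
  wo eta @[eta --> +oo] --> x.
Proof.
move=> cF cP kF P0 ux [/= Px mx] mwo; apply/cvgrPdist_lt => e e0.
have T0 : [set: 'rV[R]_M] !=set0 by exists x.
(* The global minimum [F b] bounds [F (wo eta)] from below, uniformly in [eta]. *)
have [b [_ /= mb]] := compact_sublevels_minimizer cF kF (@closedT _) T0.
have wox eta : 0 < eta -> F (wo eta) + eta * P (wo eta) <= F x.
  by move=> /mwo[_ /(_ x I)]; rewrite Px mulr0 addr0.
(* Any [wo eta] at distance at least [e] from [x] lies in [K], by [wox]. *)
pose K := [set w | F w <= F x] `&` [set w | e <= `|x - w|].
have [K0|] := pselect (K !=set0); last first.
  move=> K0; near=> eta; rewrite ltNge; apply/negP => xe; apply: K0.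
  have eta0 : 0 < eta by near: eta; exact: nbhs_pinfty_gt.
  exists (wo eta); split => //=; apply: le_trans (wox _ eta0).
  by rewrite lerDl mulr_ge0// ltW.
have kK : compact K.
  apply: compact_closedI => //.
  have -> : [set w | e <= `|x - w|] = ~` ball x e.
    by rewrite -ball_normE; apply/seteqP; split=> w /=; rewrite leNgt => /negP.
  exact/open_closedC/ball_open.
have [z zK mz] := compact_EVT_min K0 kK (continuous_subspaceT cP).
have {}zK : K z by rewrite inE in zK.
(* Otherwise [z] would be a constrained minimizer, hence [x], although it is at distance at least
   [e] from [x]. *)
have Pz : 0 < P z.
  rewrite lt_def P0 andbT; apply/eqP => Pz.
  have zx : z = x.
    apply: ux; split => // v /= /mx; apply: le_trans; by case: zK.
  by case: zK => _ /=; rewrite zx subrr normr0 leNgt e0.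
near=> eta; rewrite ltNge; apply/negP => xe.
have eta0 : 0 < eta by near: eta; exact: nbhs_pinfty_gt.
(* Past this threshold a point of [K] costs more than [F b + (F x - F b) = F x], contradicting
   [wox]. *)
have etaz : (F x - F b) / P z < eta.
  by near: eta; apply: nbhs_pinfty_gt; exact: num_real.
have wK : K (wo eta).
  split => //=; apply: le_trans (wox _ eta0); by rewrite lerDl mulr_ge0// ltW.
have Pw : P z <= P (wo eta) by apply: mz; rewrite inE.
have := wox _ eta0; rewrite ltr_pdivrMr// in etaz.
have : eta * P z <= eta * P (wo eta) by rewrite ler_pM2l.
have := mb (wo eta) I; lra.
Unshelve. all: by end_near. Qed.

End StronglyConvexMinimization.

(** * From the individual agents to sums, and from convexity to midpoints *)

Lemma sum_tangent_lower_bound (R : realType) M N (J : 'I_N -> 'rV[R]_M -> R)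
    (m : 'I_N -> R) :
  (forall k w, differentiable (J k) w) ->
  (forall k x y, J k x + 'd (J k) x (y - x) + m k * `|y - x| ^+ 2 <= J k y) ->
  forall x y, Jglob J x + 'd (Jglob J) x (y - x)
    + (\sum_(k < N) m k) * `|y - x| ^+ 2 <= Jglob J y.
Proof.
move=> dJ tJ x y.
have JE : Jglob J = \sum_(k < N) J k by apply/funext => w; rewrite fct_sumE.
(* [is_diff] carries differentiability together with the differential, so one induction gives both
   for the sum. *)
have : is_diff x (\sum_(k < N) J k) (\sum_(k < N) ('d (J k) x : 'rV[R]_M -> R)).
  elim/big_ind2 : _ => [|F dF G dG dfF dfG|k _]; first exact: is_diff_cst.
    exact: is_diffD.
  exact: differentiableP.
move=> [_ dE]; rewrite JE dE !fct_sumE mulr_suml -!big_split/=.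
exact: ler_sum.
Qed.

Lemma convex_function_midpoint (R : realType) (E : lmodType R) (f : E -> R) :
  convex_function [set: E] f ->
  forall x y, f (2^-1 *: (x + y)) <= (f x + f y) / 2.
Proof.
move=> cf x y.
have h0 : 0 <= 2^-1 :> R by lra.
have h1 : 2^-1 <= 1 :> R by lra.
have := cf (Itv01 h0 h1) x y (mem_set I) (mem_set I).
rewrite convRE /conv/= /onem.
have -> : 1 - 2^-1 = 2^-1 :> R by lra.
by rewrite -scalerDr -mulrDr mulrC.
Qed.

(** * Scalar penalty functions *)

Section Penalty.
Context {R : realType} (delta : R -> R).

Lemma ineq_penalty_ge0 : ineq_penalty delta -> forall x, 0 <= delta x.
Proof.
move=> [_ _ d0 dp] x; have [/d0->//|/dp/ltW//] := leP x 0.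
Qed.

Lemma eq_penalty_ge0 : eq_penalty delta -> forall x, 0 <= delta x.
Proof.
move=> [_ _ d0 dp] x; have [->|/dp/ltW//] := eqVneq x 0.
by rewrite d0.
Qed.

Lemma ineq_penalty_eq0 : ineq_penalty delta -> forall x, delta x = 0 <-> x <= 0.
Proof.
move=> [_ _ d0 dp] x; split; last exact: d0.
by case: leP => // /dp + dx; rewrite dx ltxx.
Qed.

Lemma eq_penalty_eq0 : eq_penalty delta -> forall x, delta x = 0 <-> x = 0.
Proof.
move=> [_ _ d0 dp] x; split=> [dx|->//].
by apply: contraPP dx => /eqP /dp + dx; rewrite dx ltxx.
Qed.

(** For [0 < x <= y], [x] is the convex combination of [y] and 0 with weight [x / y], and
    [delta 0 = 0]; so [delta x <= (x / y) * delta y <= delta y]. *)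
Lemma ineq_penalty_le : ineq_penalty delta ->
  forall x y, x <= y -> delta x <= delta y.
Proof.
move=> dIP x y xy; have dge0 := ineq_penalty_ge0 dIP.
have [_ dc d0 _] := dIP; have [/d0->//|x0] := leP x 0.
have y0 : 0 < y := lt_le_trans x0 xy.
have t0 : 0 <= x / y by rewrite divr_ge0// ltW.
have t1 : x / y <= 1 by rewrite ler_pdivrMr// mul1r.
have := dc (Itv01 t0 t1) y 0 (mem_set I) (mem_set I).
rewrite convRE (d0 0)// mulr0 addr0 /conv/= scaler0 addr0.
rewrite [_ *: _]divfK ?gt_eqF//.
move=> /le_trans; apply; exact: ler_piMl.
Qed.

End Penalty.

(** * The total penalty and the feasible set *)

Section Problem.
Context {R : realType} {N M : nat} {U L : 'I_N -> nat}.
Context (h : forall k : 'I_N, 'I_(U k) -> 'rV[R]_M -> R).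
Context (g : forall k : 'I_N, 'I_(L k) -> 'rV[R]_M -> R).
Context (deltaIP deltaEP : R -> R).
Context (deltaIP_pen : ineq_penalty deltaIP)
  (deltaEP_pen : eq_penalty deltaEP).
Local Notation penalty := (penalty h g deltaIP deltaEP).

Lemma penalty_ge0 k w : 0 <= penalty k w.
Proof.
apply: addr_ge0; apply: sumr_ge0 => i _.
  exact: ineq_penalty_ge0.
exact: eq_penalty_ge0.
Qed.

Lemma penalty_eq0 k w : penalty k w = 0 <-> constraint_set h g k w.
Proof.
have g0 (l : 'I_(L k)) : 0 <= deltaIP (g l w) by exact: ineq_penalty_ge0.
have h0 (u : 'I_(U k)) : 0 <= deltaEP (h u w) by exact: eq_penalty_ge0.
split=> [/eqP|[hw gw]].
  rewrite paddr_eq0; [|exact: sumr_ge0..] => /andP[/eqP pg /eqP ph].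
  split=> [u|l].
    by apply/(eq_penalty_eq0 deltaEP_pen); exact: (psumr_eq0P _ ph).
  by apply/(ineq_penalty_eq0 deltaIP_pen); exact: (psumr_eq0P _ pg).
rewrite /penalty !big1 ?addr0// => i _.
  by apply/(eq_penalty_eq0 deltaEP_pen).
by apply/(ineq_penalty_eq0 deltaIP_pen).
Qed.

Lemma feasible_setE :
  feasible_set h g = [set w | \sum_(k < N) penalty k w = 0].
Proof.
apply/seteqP; split => w /=.
  by move=> fw; apply: big1 => k _; apply/penalty_eq0/fw.
move=> pw k _; apply/penalty_eq0.
by apply: (psumr_eq0P _ pw) => // i _; exact: penalty_ge0.
Qed.

Context (h_affine : forall k u, affine (@h k u))
  (g_convex : forall k l, convex_function [set: 'rV[R]_M] (@g k l)).

(** Composing with convex [g] works because [deltaIP] is nondecreasing. [deltaEP] is not monotone,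
    but affine [h] sends midpoints to midpoints exactly. *)
Lemma sum_penalty_midconvex : midconvex (fun w => \sum_(k < N) penalty k w).
Proof.
move=> x y; rewrite -big_split/= mulr_suml; apply: ler_sum => k _.
rewrite /penalty addrACA -!big_split/= mulrDl !mulr_suml.
apply: lerD; apply: ler_sum => i _.
  have [_ /convex_function_midpoint dc _ _] := deltaIP_pen.
  apply: le_trans (dc (g i x) (g i y)).
  apply: ineq_penalty_le => //.
  apply: le_trans (convex_function_midpoint (g_convex i) _ _) _.
  by rewrite [leRHS]mulrC.
have [_ /convex_function_midpoint dc _ _] := deltaEP_pen.
apply: le_trans (dc (h i x) (h i y)).
have [a [b hE]] := h_affine i; rewrite !hE linearZ linearD/=.
rewrite le_eqVlt; apply/orP; left; apply/eqP; congr deltaEP.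
by rewrite /GRing.scale/=; lra.
Qed.

End Problem.

Theorem theorem1 (R : realType) (N M : nat) (U L : 'I_N -> nat)
    (J : 'I_N -> 'rV[R]_M -> R)
    (h : forall k : 'I_N, 'I_(U k) -> 'rV[R]_M -> R)
    (g : forall k : 'I_N, 'I_(L k) -> 'rV[R]_M -> R)
    (deltaIP deltaEP : R -> R)
    (N_gt0 : (0 < N)%N)
    (J_diff2 : forall k, twice_differentiable (J k))
    (h_affine : forall k u, affine (@h k u))
    (g_convex : forall k l, convex_function [set: 'rV[R]_M] (@g k l))
    (deltaIP_pen : ineq_penalty deltaIP)
    (deltaEP_pen : eq_penalty deltaEP)
    (p_diff : forall k w, differentiable (penalty h g deltaIP deltaEP k) w)
    (p_grad0 : forall k w, feasible_set h g w ->
       grad (penalty h g deltaIP deltaEP k) w = 0)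
    (feasible : feasible_set h g !=set0)
    (J_hessian : forall k, exists lmin lmax : R,
       [/\ 0 < lmin, 0 < lmax &
           forall w, loewner_le lmin%:M (hessian (J k) w) /\
                     loewner_le (hessian (J k) w) lmax%:M]) :
  [/\ exists wstar, is_minimizer (feasible_set h g) (Jglob J) wstar,
      forall eta : R, 0 < eta ->
        exists! w, is_minimizer [set: 'rV[R]_M]
                     (Jglob_pen J h g deltaIP deltaEP eta) w &
      forall (wstar : 'rV[R]_M) (wo : R -> 'rV[R]_M),
        is_minimizer (feasible_set h g) (Jglob J) wstar ->
        (forall eta, 0 < eta ->
           is_minimizer [set: 'rV[R]_M]
             (Jglob_pen J h g deltaIP deltaEP eta) (wo eta)) ->
        let woinf := lim (wo eta @[eta --> +oo]) in
        [/\ wo eta @[eta --> +oo] --> wstar,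
            euclid_norm (wstar - woinf) = 0 &
            is_minimizer (feasible_set h g) (Jglob J) woinf]].
Proof.
pose P w := \sum_(k < N) penalty h g deltaIP deltaEP k w.
(* [m k] is the lower Hessian constant of agent [k]. *)
have [m Hm] := choice J_hessian.
have m0 k : 0 < m k by have [? []] := Hm k.
have Jt k x y : J k x + 'd (J k) x (y - x) + m k / 2 * `|y - x| ^+ 2 <= J k y.
  apply: tangent_lower_bound => // w.
  by have [? [_ _ /(_ w)[]]] := Hm k.
have dJ k w : differentiable (J k) w by have [+ _] := J_diff2 k; exact.
have JE : Jglob J = \sum_(k < N) J k by apply/funext => w; rewrite fct_sumE.
have dJglob w : differentiable (Jglob J) w.
  by rewrite JE; apply: differentiable_sum.
have cJ : continuous (Jglob J) by move=> w; exact: differentiable_continuous.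
have PE : P = \sum_(k < N) penalty h g deltaIP deltaEP k.
  by apply/funext => w; rewrite fct_sumE.
have cP : continuous P.
  move=> w; apply: differentiable_continuous; rewrite PE.
  exact: differentiable_sum.
have P0 w : 0 <= P w by apply: sumr_ge0 => k _; exact: penalty_ge0.
have mP : midconvex P by exact: sum_penalty_midconvex.
set c := \sum_(k < N) m k / 2.
have c0 : 0 < c.
  (* The sum is nonempty: the term of agent 0 is isolated to get strict positivity. *)
  rewrite /c (bigD1 (Ordinal N_gt0))//= ltr_pwDl ?divr_gt0//.
  by apply: sumr_ge0 => k _; rewrite divr_ge0 ?ltW.
have tJ := sum_tangent_lower_bound dJ Jt; rewrite -/c in tJ.
have sJ := tangent_strongly_midconvex tJ.
have c40 : 0 < c / 4 by rewrite divr_gt0.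
have kJ : compact_sublevels (Jglob J).
  by apply: (tangent_compact_sublevels c0 cJ _ (tJ 0)); exact: diff_continuous.
have FE : feasible_set h g = [set w | P w = 0] by exact: feasible_setE.
have uJ x y : is_minimizer (feasible_set h g) (Jglob J) x ->
    is_minimizer (feasible_set h g) (Jglob J) y -> x = y.
  (* The feasible set is stable under midpoints, being the zero set of a nonnegative midpoint convex
     function. *)
  apply: strongly_midconvex_uniq_minimizer c40 sJ _; rewrite FE => u v /= Pu Pv.
  by apply/eqP; rewrite eq_le P0 andbT (le_trans (mP u v))// Pu Pv addr0 mul0r.
split.
- apply: compact_sublevels_minimizer => //; rewrite FE.
  (* As a sublevel set of [P], the feasible set is closed. *)
  have -> : [set w | P w = 0] = [set w | P w <= 0].
    apply/seteqP; split=> w /= Pw; first by rewrite Pw.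
    by apply/eqP; rewrite eq_le Pw P0.
  exact: closed_sublevel.
(* Adding [eta * P], which is nonnegative and midpoint convex, preserves both coercivity and strong
   midpoint convexity. *)
- move=> eta eta0; pose G w := Jglob J w + eta * P w.
  have cG : continuous G.
    move=> w; have ceta := @cst_continuous _ _ eta w : {for w, continuous _}.
    exact: continuousD (cJ w) (continuousM ceta (cP w)).
  have [] := @compact_sublevels_minimizer _ _ G setT.
  + exact: cG.
  + apply: compact_sublevels_le cG _ kJ.
    by move=> w; rewrite lerDl mulr_ge0// ltW.
  + exact: closedT.
  + by exists 0.
  move=> w mw; exists w; split => // y my.
  apply: (strongly_midconvex_uniq_minimizer c40 _ _ mw my) => //.
  apply: midconvexD_strongly sJ _ => u v.
  by rewrite -mulrDr -mulrA ler_wpM2l ?(ltW eta0)//; exact: mP.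
move=> wstar wo mstar mwo woinf.
have wo_cvg : wo eta @[eta --> +oo] --> wstar.
  apply: (penalty_method_cvg cJ cP kJ P0) => //; rewrite -?FE// => y my.
  exact: uJ.
have -> : woinf = wstar by apply: cvg_lim wo_cvg; exact: norm_hausdorff.
split=> //; rewrite subrr /euclid_norm big1 ?sqrtr0// => i _.
by rewrite mxE expr0n.
Qed.
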